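(* Let $\alpha_1,\alpha_2,\beta,c_1,c_2,d$ be real constants with $\alpha_1>0$, $\alpha_2>0$ and $\beta^2<4\alpha_1\alpha_2$. Consider the finite difference scheme $$[1+\iota\,\delta t\,A_{h,k}]\phi^{(n+1)}_{i,j}=[1-(1-\iota)\,\delta t\,A_{h,k}]\phi^{(n)}_{i,j}+\iota\,\delta t\, s^{(n+1)}_{i,j}+(1-\iota)\,\delta t\, s^{(n)}_{i,j}$$ with these constant coefficients, where $A_{h,k}$ is the compact discrete operator and $\iota$ the weighted time average parameter described in the context. Then, for $d\ge 0$, the scheme is stable in the von Neumann sense if $0.5\le\iota\le 1$; and for $d<0$ the scheme is stable under the sufficient condition $\delta t<-\dfrac{1}{\iota d}$.
   Context: The scheme discretizes the parabolic equation $\partial_t\phi-\alpha_1\phi_{xx}-\beta\phi_{xy}-\alpha_2\phi_{yy}+c_1\phi_x+c_2\phi_y+d\phi=s$ in two space dimensions on a uniform grid with spacing $h$ in $x$ (index $i$), $k$ in $y$ (index $j$) and time step $\delta t$ (time level $n$). The parameter $\iota$, with $0\le\iota\le1$, is the weighted time average parameter ($\iota=0$: forward Euler; $\iota=0.5$: Crank-Nicolson; $\iota=1$: backward Euler). The usual central difference operators are $\delta_x f_{i,j}=\frac{f_{i+1,j}-f_{i-1,j}}{2h}$, $\delta_y f_{i,j}=\frac{f_{i,j+1}-f_{i,j-1}}{2k}$, $\delta_x^2 f_{i,j}=\frac{f_{i+1,j}-2f_{i,j}+f_{i-1,j}}{h^2}$, $\delta_y^2 f_{i,j}=\frac{f_{i,j+1}-2f_{i,j}+f_{i,j-1}}{k^2}$.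 The discrete operator is $$A_{h,k}\phi_{i,j}=(-2\alpha_1\delta_x^2-2\alpha_2\delta_y^2+\beta\,\delta_x\delta_y+d)\phi_{i,j}+(\alpha_1\delta_x-\beta\,\delta_y+c_1)\phi_{x_{i,j}}+(\alpha_2\delta_y-\beta\,\delta_x+c_2)\phi_{y_{i,j}},$$ where the grid functions $\phi_x,\phi_y$ are obtained from $\phi$ by the Padé approximations $$\Big(1+\tfrac{h^2}{6}\delta_x^2\Big)\phi_{x_{i,j}}=\delta_x\phi_{i,j},\qquad \Big(1+\tfrac{k^2}{6}\delta_y^2\Big)\phi_{y_{i,j}}=\delta_y\phi_{i,j}.$$ Von Neumann analysis: periodic boundary conditions are assumed, and one considers solutions of the difference equation (without the forcing terms) of the form $\phi^{(n)}_{i,j}=b^{(n)}e^{I\theta_x i}e^{I\theta_y j}$, where $I=\sqrt{-1}$, $b^{(n)}$ is the amplitude at time level $n$, and $\theta_x=2\pi h/\Lambda_1$, $\theta_y=2\pi k/\Lambda_2$ are phase angles with wavelengths $\Lambda_1,\Lambda_2$. The amplification factor, for all $\theta_x,\theta_y\in[0,2\pi)$, is $|G|:=|b^{(n+1)}/b^{(n)}|$. For $d\ge0$, stability means $|G|\le1$ for all phase angles (with no restriction on $\delta t$, i.e. unconditional stability). For $d<0$, which corresponds to a growth term in the equation, the stability condition is $|G|<1+K\delta t$ with $K$ independent of $\delta t$.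
   Formalization: For d<0 and ι>0 no single K serves all δt<-1/(ιd), since at zero phase angles G tends to infinity as δt approaches -1/(ιd); K is instead uniform on 0<δt≤τ for each τ<-1/(ιd), and for ι=0 the bound is read as +∞. *)

(* Defs.v *)
From HB Require Import structures.
From mathcomp Require Import all_boot all_order all_algebra.
From mathcomp Require Import complex.
From mathcomp Require Import reals trigo.

Set Implicit Arguments.
Unset Strict Implicit.
Unset Printing Implicit Defensive.

Import Order.TTheory GRing.Theory Num.Theory.
Local Open Scope ring_scope.
Local Open Scope complex_scope.

Definition grid (R : realType) := int -> int -> R[i].

Section DifferenceOperators.
Variables (R : realType) (h k : R).
Implicit Type f : grid R.

Definition delta_x f : grid R :=
  fun i j => (f (i + 1) j - f (i - 1) j) / (2 * h)%:C.

Definition delta_y f : grid R :=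
  fun i j => (f i (j + 1) - f i (j - 1)) / (2 * k)%:C.

Definition delta_x2 f : grid R :=
  fun i j => (f (i + 1) j - 2 * f i j + f (i - 1) j) / (h ^+ 2)%:C.

Definition delta_y2 f : grid R :=
  fun i j => (f i (j + 1) - 2 * f i j + f i (j - 1)) / (k ^+ 2)%:C.

Definition bounded_grid f : Prop :=
  exists M : R, forall i j, `|f i j| <= M%:C.

(* On the whole lattice the implicit Pade relation determines phi_x only up to
   adding C1(j) * (-2 + sqrt 3)^i + C2(j) * (-2 - sqrt 3)^i.  Periodic boundary
   conditions exclude these spurious terms; since a Fourier mode with an
   arbitrary phase angle need not be periodic in the integer index,
   boundedness, which periodicity implies and which suffices to exclude them,
   is imposed instead. *)
Definition pade_x (phi phix : grid R) : Prop :=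
  bounded_grid phix /\
  forall i j,
    phix i j + (h ^+ 2 / 6)%:C * delta_x2 phix i j = delta_x phi i j.

Definition pade_y (phi phiy : grid R) : Prop :=
  bounded_grid phiy /\
  forall i j,
    phiy i j + (k ^+ 2 / 6)%:C * delta_y2 phiy i j = delta_y phi i j.

End DifferenceOperators.

Section Scheme.
Variables (R : realType) (alpha1 alpha2 beta c1 c2 d h k iota dt : R).

Definition compact_op (phi phix phiy : grid R) : grid R := fun i j =>
  (- (2 * alpha1)%:C * delta_x2 h phi i j - (2 * alpha2)%:C * delta_y2 k phi i j
   + beta%:C * delta_x h (delta_y k phi) i j + d%:C * phi i j)
  + (alpha1%:C * delta_x h phix i j - beta%:C * delta_y k phix i j
     + c1%:C * phix i j)
  + (alpha2%:C * delta_y k phiy i j - beta%:C * delta_x h phiy i j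
     + c2%:C * phiy i j).

Definition scheme_solution (s phi : nat -> grid R) : Prop :=
  exists phix phiy : nat -> grid R,
    [/\ forall n, pade_x h (phi n) (phix n),
        forall n, pade_y k (phi n) (phiy n)
      & forall n i j,
          phi n.+1 i j
          + (iota * dt)%:C
            * compact_op (phi n.+1) (phix n.+1) (phiy n.+1) i j
          = phi n i j
            - ((1 - iota) * dt)%:C * compact_op (phi n) (phix n) (phiy n) i j
            + (iota * dt)%:C * s n.+1 i j + ((1 - iota) * dt)%:C * s n i j].

Definition expI (t : R) : R[i] := cos t +i* sin t.

Definition fourier_mode (tx ty : R) (b : R[i]) : grid R :=
  fun i j => b * expI (tx *~ i) * expI (ty *~ j).

Definition mode_solution (tx ty : R) (b : nat -> R[i]) : Prop :=
  scheme_solution (fun _ _ _ => 0) (fun n => fourier_mode tx ty (b n)).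

(* The first clause guarantees that nonzero modes exist, so that G is
   uniquely determined. *)
Definition amplification_factor (tx ty : R) (G : R[i]) : Prop :=
  (exists b, mode_solution tx ty b /\ b 0%N != 0) /\
  forall b n, mode_solution tx ty b -> b n != 0 -> b n.+1 / b n = G.

Definition phase_angle (t : R) : Prop := 0 <= t < 2 * pi.

Definition von_neumann_stable : Prop :=
  forall tx ty, phase_angle tx -> phase_angle ty ->
    exists G, amplification_factor tx ty G /\ `|G| <= 1.

Definition von_neumann_growth_bounded (K : R) : Prop :=
  forall tx ty, phase_angle tx -> phase_angle ty ->
    exists G, amplification_factor tx ty G /\ `|G| < (1 + K * dt)%:C.

End Scheme.

(* Main.v *)
(* The Pade relations determine the bounded derivatives of a Fourier mode, so
   on modes the compact operator is multiplication by a complex number lam.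
   Its real part minus d is alpha1 P + alpha2 Q + beta S with P, Q >= 0 and
   S ^ 2 <= P Q, hence it is nonnegative when beta ^ 2 < 4 alpha1 alpha2.
   With z = dt lam the amplification factor is
   (1 - (1 - iota) z) / (1 + iota z), and
   |1 - (1 - iota) z| ^ 2 = |1 + iota z| ^ 2 - 2 Re z - (2 iota - 1) |z| ^ 2.
   For d >= 0 this gives |G| <= 1.  For d < 0 the denominator has real part
   at least 1 + iota tau d > 0, and the modulus of the numerator exceeds that
   of the denominator by at most O(dt). *)

Require Import Defs.
From HB Require Import structures.
From mathcomp Require Import all_boot all_order all_algebra.
From mathcomp Require Import complex.
From mathcomp Require Import reals trigo.
From mathcomp Require Import ring lra boolp.
Import Order.TTheory GRing.Theory Num.Theory.
Local Open Scope ring_scope.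

(** * Action of the difference operators on Fourier modes *)

Lemma expID (R : realType) (s t : R) : expI (s + t) = expI s * expI t.
Proof. by rewrite /expI cosD sinD [sin s * _ + _]addrC. Qed.

Lemma norm_expI (R : realType) (t : R) : `|expI t| = 1.
Proof. by rewrite normc_def /= cos2Dsin2 sqrtr1. Qed.

Lemma fourier_mode_succ_x (R : realType) (tx ty : R) b i j :
  fourier_mode tx ty b (i + 1) j = fourier_mode tx ty (expI tx * b) i j.
Proof. by rewrite /fourier_mode mulrzDr expID mulr1z; ring. Qed.

Lemma fourier_mode_pred_x (R : realType) (tx ty : R) b i j :
  fourier_mode tx ty b (i - 1) j = fourier_mode tx ty (expI (- tx) * b) i j.
Proof. by rewrite /fourier_mode mulrzBr expID mulr1z; ring. Qed.

(** Swapping the axes reduces each statement in [y] to its counterpart in [x]. *)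
Lemma fourier_modeC (R : realType) (tx ty : R) b :
  fourier_mode tx ty b = fun i j => fourier_mode ty tx b j i.
Proof. by apply/funext => i; apply/funext => j; rewrite /fourier_mode mulrAC. Qed.

Lemma delta_x_mode (R : realType) (h tx ty : R) b : h != 0 ->
  delta_x h (fourier_mode tx ty b) =
  fourier_mode tx ty (Complex 0 (sin tx / h) * b).
Proof.
move=> h0; apply/funext => i; apply/funext => j.
rewrite /delta_x fourier_mode_succ_x fourier_mode_pred_x /fourier_mode.
have -> : Complex 0 (sin tx / h) = (expI tx - expI (- tx)) / (2 * h)%:C%C.
  have u : (2 * h)%:C%C != 0 by rewrite eq_complex /= eqxx andbT mulf_neq0 ?pnatr_eq0.
  apply: (canRL (mulfK u)); apply/eqP.
  by rewrite eq_complex /= cosN sinN; apply/andP; split; apply/eqP; field.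
by ring.
Qed.

Lemma delta_x2_mode (R : realType) (h tx ty : R) b : h != 0 ->
  delta_x2 h (fourier_mode tx ty b) =
  fourier_mode tx ty (((2 * cos tx - 2) / h ^+ 2)%:C%C * b).
Proof.
move=> h0; apply/funext => i; apply/funext => j.
rewrite /delta_x2 fourier_mode_succ_x fourier_mode_pred_x /fourier_mode.
have -> : ((2 * cos tx - 2) / h ^+ 2)%:C%C =
    (expI tx - 2 + expI (- tx)) / (h ^+ 2)%:C%C.
  have u : (h ^+ 2)%:C%C != 0 by rewrite eq_complex /= eqxx andbT expf_neq0.
  apply: (canRL (mulfK u)); apply/eqP.
  by rewrite eq_complex /= cosN sinN; apply/andP; split; apply/eqP; field.
by ring.
Qed.

Lemma delta_y_mode (R : realType) (k tx ty : R) b : k != 0 ->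
  delta_y k (fourier_mode tx ty b) =
  fourier_mode tx ty (Complex 0 (sin ty / k) * b).
Proof.
by move=> k0; rewrite [in LHS]fourier_modeC [RHS]fourier_modeC -delta_x_mode.
Qed.

Lemma delta_y2_mode (R : realType) (k tx ty : R) b : k != 0 ->
  delta_y2 k (fourier_mode tx ty b) =
  fourier_mode tx ty (((2 * cos ty - 2) / k ^+ 2)%:C%C * b).
Proof.
by move=> k0; rewrite [in LHS]fourier_modeC [RHS]fourier_modeC -delta_x2_mode.
Qed.

(** * Padé derivatives of a Fourier mode *)

(* The central coefficient 4 dominates the two neighbours, so a bound [M]
   improves to [M / 2]; iterating leaves only zero. *)
Lemma bounded_pade_kernel (R : realType) (e : int -> R[i]) (M : R) :
  (forall i, `|e i| <= M%:C%C) ->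
  (forall i, 4 * e i + (e (i + 1) + e (i - 1)) = 0) ->
  forall i, e i = 0.
Proof.
move=> eM rec.
have halve n i : 2 ^+ n * `|e i| <= M%:C%C.
  elim: n i => [|n IH] i; first by rewrite mul1r.
  have -> : e i = - (e (i + 1) + e (i - 1)) / 4.
    by rewrite -(addr0_eq (rec i)); field.
  rewrite normrM normrN normfV (ger0_norm (_ : 0 <= 4)) //.
  have -> : 2 ^+ n.+1 * (`|e (i + 1) + e (i - 1)| / 4)
          = 2 ^+ n * `|e (i + 1) + e (i - 1)| / 2 by rewrite exprS; field.
  rewrite ler_pdivrMr // mulr_natr [leRHS]mulr2n.
  apply: le_trans (lerD (IH (i + 1)) (IH (i - 1))).
  by rewrite -mulrDr; apply: ler_wpM2l; [exact: exprn_ge0|exact: ler_normD].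
move=> i; apply/eqP/negP => /negP ei0.
have: 0 < `|e i| by rewrite normr_gt0.
rewrite normc_def; set x := Num.sqrt _ => x0.
have {}x0 : 0 < x by rewrite -ltcR.
(* A nonzero [e i] of modulus [x] is refuted by any [n] with [M / x < 2 ^+ n]. *)
have /= := halve (Num.Def.archi_bound (M / x)) i; set n := Num.Def.archi_bound _.
have nM : M / x < 2 ^+ n by apply: upper_nthrootP.
rewrite normc_def -/x (_ : 2 ^+ n * _ = (2 ^+ n * x)%:C%C); last first.
  by rewrite rmorphM rmorphXn rmorph_nat.
by rewrite lecR leNgt -ltr_pdivrMr // nM.
Qed.

(** The Padé derivative has symbol [I * pade_slope h t]: the symbol [I * sin t / h] of the central
    difference is divided by [1 + (2 * cos t - 2) / 6 = (2 + cos t) / 3]. *)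
Definition pade_slope {R : realType} (h t : R) : R := 3 * sin t / (h * (2 + cos t)).

Lemma cosD2_gt0 {R : realType} (t : R) : 0 < 2 + cos t.
Proof. have := cos_geN1 t; lra. Qed.

Lemma bounded_mode (R : realType) (tx ty : R) b : bounded_grid (fourier_mode tx ty b).
Proof.
exists (complex.Re `|b|) => i j.
by rewrite /fourier_mode !normrM !norm_expI !mulr1 normc_def.
Qed.

(** The mode [g] solves the relation by the choice of [pade_slope]. The difference of two bounded
    solutions is a bounded element of the kernel, hence zero. *)
Lemma pade_x_mode (R : realType) (h tx ty : R) b phix : h != 0 ->
  pade_x h (fourier_mode tx ty b) phix <->
  phix = fourier_mode tx ty (Complex 0 (pade_slope h tx) * b).
Proof.
move=> h0.
have c0 := lt0r_neq0 (cosD2_gt0 tx).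
have u2 : (h ^+ 2)%:C%C != 0 by rewrite eq_complex /= eqxx andbT expf_neq0.
set g := fourier_mode _ _ (Complex _ _ * _).
have pg : pade_x h (fourier_mode tx ty b) g.
  split=> [|i j]; first exact: bounded_mode.
  rewrite /g delta_x2_mode // delta_x_mode // /fourier_mode.
  have -> : Complex 0 (sin tx / h) = (1 + (h ^+ 2 / 6)%:C%C
     * ((2 * cos tx - 2) / h ^+ 2)%:C%C) * Complex 0 (pade_slope h tx).
    apply/eqP; rewrite eq_complex /= /pade_slope.
    by apply/andP; split; apply/eqP; field; rewrite ?h0 ?c0.
  by ring.
split=> [[[M1 bM1] e1]|->//].
case: pg => [[M2 bM2] e2].
apply/funext => i; apply/funext => j; apply/eqP; rewrite -subr_eq0; apply/eqP.
apply: (@bounded_pade_kernel R (fun i => phix i j - g i j) (M1 + M2)) => {}i.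
  by rewrite rmorphD (le_trans (ler_normB _ _)) // lerD.
have : (phix i j + (h ^+ 2 / 6)%:C%C * delta_x2 h phix i j)
     - (g i j + (h ^+ 2 / 6)%:C%C * delta_x2 h g i j) = 0.
  by rewrite e1 e2 subrr.
(* Multiplication by 6 clears the weight [h ^+ 2 / 6], so that the central coefficient [1 - 2 / 6]
   becomes 4 and the neighbours get 1. *)
rewrite /delta_x2 (rmorphM _ (h ^+ 2)) fmorphV (rmorph_nat _ 6) => /(congr1 ( *%R 6)).
rewrite mulr0 => <-.
by field; rewrite -[_ h]/(h%:C%C) eq_complex /= eqxx andbT.
Qed.

Lemma pade_y_mode (R : realType) (k tx ty : R) b phiy : k != 0 ->
  pade_y k (fourier_mode tx ty b) phiy <->
  phiy = fourier_mode tx ty (Complex 0 (pade_slope k ty) * b).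
Proof.
move=> k0; rewrite [in X in X <-> _]fourier_modeC [fourier_mode _ _ (_ * _)]fourier_modeC.
have -> : pade_y k (fun i j => fourier_mode ty tx b j i) phiy <->
    pade_x k (fourier_mode ty tx b) (fun i j => phiy j i).
  by split=> -[[M bM] e]; (split; first by exists M => i j; apply: bM) => i j; apply: e.
rewrite pade_x_mode //; split => [E|->] //.
by apply/funext => i; apply/funext => j; rewrite -E.
Qed.

(** * Symbol of the compact operator *)

(** Symbol of the terms multiplied by [alpha1] (or [alpha2]), factored so that its sign is
    visible. *)
Definition diffusion_symbol {R : realType} (h t : R) : R :=
  (1 - cos t) * (5 + cos t) / (2 + cos t) / h ^+ 2.

Lemma diffusion_symbolE {R : realType} (h t : R) : h != 0 ->
  diffusion_symbol h t =
  - 2 * ((2 * cos t - 2) / h ^+ 2) - sin t / h * pade_slope h t.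
Proof.
move=> h0; have c0 := lt0r_neq0 (cosD2_gt0 t).
have -> : sin t / h * pade_slope h t = 3 * sin t ^+ 2 / (h ^+ 2 * (2 + cos t)).
  by rewrite /pade_slope; field; rewrite h0 c0.
by rewrite sin2cos2 /diffusion_symbol; field; rewrite h0 c0.
Qed.

(** Symbol of the three terms multiplied by [beta]. The last factor collects the two Padé terms and,
    as -1, the product of the two central differences. *)
Definition mixed_symbol {R : realType} (h k tx ty : R) : R :=
  sin tx / h * (sin ty / k) * (3 / (2 + cos tx) + 3 / (2 + cos ty) - 1).

Definition parabolic_symbol {R : realType} (alpha1 alpha2 beta h k tx ty : R) : R :=
  alpha1 * diffusion_symbol h tx + alpha2 * diffusion_symbol k ty
  + beta * mixed_symbol h k tx ty.

Definition convection_symbol {R : realType} (c1 c2 h k tx ty : R) : R :=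
  c1 * pade_slope h tx + c2 * pade_slope k ty.

Definition compact_symbol {R : realType} (alpha1 alpha2 beta c1 c2 d h k tx ty : R) :
    R[i] :=
  Complex (parabolic_symbol alpha1 alpha2 beta h k tx ty + d)
          (convection_symbol c1 c2 h k tx ty).

Lemma compact_op_mode (R : realType) (alpha1 alpha2 beta c1 c2 d h k tx ty : R) b :
  h != 0 -> k != 0 ->
  compact_op alpha1 alpha2 beta c1 c2 d h k (fourier_mode tx ty b)
    (fourier_mode tx ty (Complex 0 (pade_slope h tx) * b))
    (fourier_mode tx ty (Complex 0 (pade_slope k ty) * b))
  = fourier_mode tx ty (compact_symbol alpha1 alpha2 beta c1 c2 d h k tx ty * b).
Proof.
move=> h0 k0; apply/funext => i; apply/funext => j.
rewrite /compact_op delta_x2_mode // delta_y2_mode // !delta_y_mode //.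
rewrite !delta_x_mode // /fourier_mode.
have c0 := lt0r_neq0 (cosD2_gt0 tx).
have c0' := lt0r_neq0 (cosD2_gt0 ty).
set E := expI _; set E' := expI _.
rewrite [RHS](_ : _ =
  compact_symbol alpha1 alpha2 beta c1 c2 d h k tx ty * (b * E * E')); last by ring.
have -> : compact_symbol alpha1 alpha2 beta c1 c2 d h k tx ty =
  - (2 * alpha1)%:C%C * ((2 * cos tx - 2) / h ^+ 2)%:C%C
  - (2 * alpha2)%:C%C * ((2 * cos ty - 2) / k ^+ 2)%:C%C
  + beta%:C%C * (Complex 0 (sin tx / h) * Complex 0 (sin ty / k)) + d%:C%C
  + (alpha1%:C%C * Complex 0 (sin tx / h) - beta%:C%C * Complex 0 (sin ty / k) + c1%:C%C)
    * Complex 0 (pade_slope h tx)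
  + (alpha2%:C%C * Complex 0 (sin ty / k) - beta%:C%C * Complex 0 (sin tx / h) + c2%:C%C)
    * Complex 0 (pade_slope k ty).
  apply/eqP; rewrite eq_complex /= /parabolic_symbol /convection_symbol.
  rewrite !diffusion_symbolE // /mixed_symbol /pade_slope.
  by apply/andP; split; apply/eqP; field; rewrite ?h0 ?k0 ?c0 ?c0'.
by ring.
Qed.

(** * Scalar recurrence and amplification factor *)

Lemma mode_solutionP {R : realType}
    (alpha1 alpha2 beta c1 c2 d h k iota dt tx ty : R) b :
  h != 0 -> k != 0 ->
  let lam := compact_symbol alpha1 alpha2 beta c1 c2 d h k tx ty in
  mode_solution alpha1 alpha2 beta c1 c2 d h k iota dt tx ty b <->
  forall n, b n.+1 * (1 + (iota * dt)%:C%C * lam)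
          = b n * (1 - ((1 - iota) * dt)%:C%C * lam).
Proof.
move=> h0 k0 lam; split=> [[phix [phiy [px py eqn]]] n | rec].
  have ex m := iffLR (pade_x_mode _ _ _ _ _ _ h0) (px m).
  have ey m := iffLR (pade_y_mode _ _ _ _ _ _ k0) (py m).
  (* At the origin both exponentials equal 1, which leaves a relation between amplitudes only. *)
  have := eqn n 0 0; rewrite !ex !ey !compact_op_mode //.
  rewrite /fourier_mode !mulr0z /expI cos0 sin0 -/lam => e.
  have {}e : b n.+1 + (iota * dt)%:C%C * (lam * b n.+1)
           = b n - ((1 - iota) * dt)%:C%C * (lam * b n).
    by move: e; rewrite !(mulr1, mulr0, addr0).
  by transitivity (b n.+1 + (iota * dt)%:C%C * (lam * b n.+1));
    [ring | rewrite e; ring].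
exists (fun n => fourier_mode tx ty (Complex 0 (pade_slope h tx) * b n)),
       (fun n => fourier_mode tx ty (Complex 0 (pade_slope k ty) * b n)).
split=> [n|n|n i j]; first exact/pade_x_mode; first exact/pade_y_mode.
rewrite !compact_op_mode // -/lam /fourier_mode !mulr0 !addr0.
set X := expI _; set Y := expI _.
transitivity (b n.+1 * (1 + (iota * dt)%:C%C * lam) * X * Y); first by ring.
by rewrite rec; ring.
Qed.

Lemma amplification_factorP {R : realType}
    (alpha1 alpha2 beta c1 c2 d h k iota dt tx ty : R) :
  h != 0 -> k != 0 ->
  let lam := compact_symbol alpha1 alpha2 beta c1 c2 d h k tx ty in
  1 + (iota * dt)%:C%C * lam != 0 ->
  amplification_factor alpha1 alpha2 beta c1 c2 d h k iota dt tx ty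
    ((1 - ((1 - iota) * dt)%:C%C * lam) / (1 + (iota * dt)%:C%C * lam)).
Proof.
move=> h0 k0 lam D0; split.
  (* The geometric sequence with the claimed ratio is a mode starting from 1. *)
  exists (fun n => ((1 - ((1 - iota) * dt)%:C%C * lam) /
                    (1 + (iota * dt)%:C%C * lam)) ^+ n).
  split; last by rewrite expr0 oner_neq0.
  by apply/mode_solutionP => // n; rewrite -/lam exprSr -mulrA divfK.
move=> b n /(mode_solutionP _ _ _ _ _ _ _ _ _ _ _ _ _ h0 k0)/(_ n) rec bn0.
by rewrite -/lam in rec; apply/eqP; rewrite eqr_div // rec mulrC.
Qed.

(** * Bounds on the diffusion, mixed and convection symbols *)

(* With [p], [q] the two cosines, both [9 (1 + p) <= (5 + p) (2 + p)] and
   [8 + p + q - p q <= 9] reduce to [0 <= (1 - p) ^+ 2] and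
   [0 <= (1 - p) * (1 - q)]. *)
Lemma mixed_symbol_sqr {R : realType} (h k tx ty : R) : h != 0 -> k != 0 ->
  mixed_symbol h k tx ty ^+ 2 <= diffusion_symbol h tx * diffusion_symbol k ty.
Proof.
move=> h0 k0; rewrite /mixed_symbol /diffusion_symbol !exprMn !sin2cos2.
have := cosD2_gt0 tx; have := cosD2_gt0 ty.
have := cos_geN1 tx; have := cos_geN1 ty; have := cos_le1 tx; have := cos_le1 ty.
move: (cos tx) (cos ty) => p q q1 p1 qN1 pN1 q2 p2.
(* [F] is common to both sides once each squared sine is split as [(1 - p) * (1 + p)]. *)
set F := (1 - p) * (1 - q) / (h * k * (2 + p) * (2 + q)) ^+ 2.
have F0 : 0 <= F by rewrite mulr_ge0 ?invr_ge0 ?sqr_ge0 // mulr_ge0 ?subr_ge0.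
rewrite [leLHS](_ : _ = F * ((1 + p) * (1 + q) * (8 + p + q - p * q) ^+ 2)); last first.
  by rewrite /F; field; rewrite h0 k0 (lt0r_neq0 p2) (lt0r_neq0 q2).
rewrite [leRHS](_ : _ = F * ((5 + p) * (2 + p) * ((5 + q) * (2 + q)))); last first.
  by rewrite /F; field; rewrite h0 k0 (lt0r_neq0 p2) (lt0r_neq0 q2).
apply: ler_wpM2l => //.
have hp : 9 * (1 + p) <= (5 + p) * (2 + p) by have := sqr_ge0 (1 - p); lra.
have hq : 9 * (1 + q) <= (5 + q) * (2 + q) by have := sqr_ge0 (1 - q); lra.
have hp0 : 0 <= 9 * (1 + p) by lra.
have hq0 : 0 <= 9 * (1 + q) by lra.
apply: le_trans (ler_pM hp0 hq0 hp hq).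
rewrite (_ : 9 * (1 + p) * _ = (1 + p) * (1 + q) * 9 ^+ 2); last by ring.
apply: ler_wpM2l; first by rewrite mulr_ge0; lra.
have : 0 <= (1 - p) * (1 - q) by rewrite mulr_ge0 ?subr_ge0.
(* This one gives [8 + p + q - p * q >= 7 + 2 * p > 0], needed to compare squares. *)
have : 0 <= (1 - p) * (1 + q) by rewrite mulr_ge0; lra.
by move=> m1 m2; rewrite ler_sqr ?nnegrE; lra.
Qed.

Lemma diffusion_symbol_ge0 {R : realType} (h t : R) : 0 <= diffusion_symbol h t.
Proof.
rewrite /diffusion_symbol !mulr_ge0 ?invr_ge0 ?sqr_ge0 ?(ltW (cosD2_gt0 t)) //.
  by rewrite subr_ge0 cos_le1.
have := cos_geN1 t; lra.
Qed.

(** The numerator factors are at most 2 and 6, and the denominator [2 + cos t] is at least 1. *)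
Lemma diffusion_symbol_le {R : realType} (h t : R) : diffusion_symbol h t <= 12 / h ^+ 2.
Proof.
have c1 := cos_le1 t; have c2 := cos_geN1 t.
rewrite /diffusion_symbol ler_wpM2r ?invr_ge0 ?sqr_ge0 // ler_pdivrMr ?cosD2_gt0 //.
nra.
Qed.

(** With [P], [Q], [S] the symbols, [(beta S)^2 <= 4 alpha1 alpha2 P Q <= (alpha1 P + alpha2 Q)^2],
    the last step being the arithmetic-geometric mean inequality. The absolute value serves both the
    sign and the upper bound of the parabolic symbol. *)
Lemma mixed_symbol_le {R : realType} (alpha1 alpha2 beta h k tx ty : R) :
  h != 0 -> k != 0 -> 0 < alpha1 -> 0 < alpha2 -> beta ^+ 2 < 4 * alpha1 * alpha2 ->
  `|beta * mixed_symbol h k tx ty| <=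
  alpha1 * diffusion_symbol h tx + alpha2 * diffusion_symbol k ty.
Proof.
move=> h0 k0 a1 a2 /ltW hb.
have := mixed_symbol_sqr h k tx ty h0 k0.
have := diffusion_symbol_ge0 h tx; have := diffusion_symbol_ge0 k ty.
move: (mixed_symbol _ _ _ _) (diffusion_symbol _ _) (diffusion_symbol _ _)
  => S P Q Q0 P0 hS.
rewrite -ler_sqr ?nnegrE ?addr_ge0 ?mulr_ge0 ?(ltW a1) ?(ltW a2) //.
rewrite real_normK ?num_real // exprMn.
have := ler_pM (sqr_ge0 beta) (sqr_ge0 S) hb hS => /le_trans -> //.
rewrite -subr_ge0 (_ : _ - _ = (alpha1 * P - alpha2 * Q) ^+ 2) ?sqr_ge0 //.
by ring.
Qed.

Lemma pade_slope_le {R : realType} (h t : R) : 0 < h -> `|pade_slope h t| <= 3 / h.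
Proof.
move=> h0; have c0 := cosD2_gt0 t; have c1 := cos_geN1 t.
rewrite /pade_slope normrM normfV (gtr0_norm (mulr_gt0 h0 c0)).
rewrite ler_pdivrMr ?mulr_gt0 // mulrA divfK ?lt0r_neq0 //.
by rewrite normrM (ger0_norm (_ : 0 <= 3)) // ler_pM // (le_trans (sin_max t)) //; lra.
Qed.

(** * Modulus of the amplification factor *)

Lemma norm_ratio_le {R : realType} (N D : R[i]) (C : R) : 0 <= C -> D != 0 ->
  complex.Re N ^+ 2 + complex.Im N ^+ 2 <=
    C ^+ 2 * (complex.Re D ^+ 2 + complex.Im D ^+ 2) ->
  `|N / D| <= C%:C%C.
Proof.
move=> C0 D0 le; rewrite normrM normfV ler_pdivrMr ?normr_gt0 //.
rewrite !normc_def -rmorphM lecR -[leRHS]/(_ * Num.sqrt _) -{1}(ger0_norm C0) -sqrtr_sqr.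
by rewrite -sqrtrM ?sqr_ge0 // ler_wsqrtr.
Qed.

Lemma norm_ratio_lt {R : realType} (N D : R[i]) (C : R) : 0 <= C -> D != 0 ->
  complex.Re N ^+ 2 + complex.Im N ^+ 2 <
    C ^+ 2 * (complex.Re D ^+ 2 + complex.Im D ^+ 2) ->
  `|N / D| < C%:C%C.
Proof.
move=> C0 D0 lt; rewrite normrM normfV ltr_pdivrMr ?normr_gt0 //.
rewrite !normc_def -rmorphM ltcR -[ltRHS]/(_ * Num.sqrt _) -{1}(ger0_norm C0) -sqrtr_sqr.
rewrite -sqrtrM ?sqr_ge0 // ltr_sqrt // (le_lt_trans _ lt) //.
by rewrite addr_ge0 // sqr_ge0.
Qed.

Lemma theta_factor_le1 {R : realType} (iota dt x y : R) :
  1 / 2 <= iota -> 0 < dt -> 0 <= x ->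
  1 + (iota * dt)%:C%C * Complex x y != 0 /\
  `|(1 - ((1 - iota) * dt)%:C%C * Complex x y) /
    (1 + (iota * dt)%:C%C * Complex x y)| <= 1.
Proof.
move=> hi hdt hx.
have idt : 0 < iota * dt by rewrite mulr_gt0 //; lra.
have idtx : 0 <= iota * dt * x by rewrite mulr_ge0 // ltW.
have D0 : 1 + (iota * dt)%:C%C * Complex x y != 0.
  rewrite eq_complex negb_and; apply/orP; left.
  apply: lt0r_neq0; rewrite /=; lra.
split=> //; apply: (norm_ratio_le _ _ 1) => //=.
have h1 : 0 <= dt * x by rewrite mulr_ge0 // ltW.
have h2 : 0 <= (2 * iota - 1) * (dt ^+ 2 * (x ^+ 2 + y ^+ 2)).
  apply: mulr_ge0; first by lra.
  by rewrite mulr_ge0 ?addr_ge0 ?sqr_ge0.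
lra.
Qed.

(** The last hypothesis bounds the excess of the squared modulus of the numerator over that of the
    denominator. Since the latter is at least [e ^+ 2], the excess is absorbed by
    [(2 K dt + (K dt)^2) e^2] as soon as [M < K e^2] and [M <= K e]. *)
Lemma theta_factor_lt {R : realType} (iota dt x y e M : R) :
  0 < dt -> 0 < e -> e <= 1 + iota * dt * x -> 0 <= M ->
  - 2 * dt * x - (2 * iota - 1) * (dt ^+ 2 * (x ^+ 2 + y ^+ 2))
    <= 2 * dt * M + dt ^+ 2 * M ^+ 2 ->
  1 + (iota * dt)%:C%C * Complex x y != 0 /\
  `|(1 - ((1 - iota) * dt)%:C%C * Complex x y) /
    (1 + (iota * dt)%:C%C * Complex x y)|
    < (1 + (M / e ^+ 2 + M / e + 1) * dt)%:C%C.
Proof.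
move=> dt0 e0 eD M0 hM.
have D0 : 1 + (iota * dt)%:C%C * Complex x y != 0.
  rewrite eq_complex negb_and; apply/orP; left.
  apply: lt0r_neq0; rewrite /=; lra.
(* The first two summands secure the two conditions on [K]; the 1 makes the inequality strict. *)
set K := M / e ^+ 2 + M / e + 1.
have m1 : 0 <= M / e ^+ 2 by rewrite divr_ge0 // sqr_ge0.
have m2 : 0 <= M / e by rewrite divr_ge0 // ltW.
have K0 : 0 < K by rewrite /K; lra.
split=> //; apply: norm_ratio_lt => //=.
  by rewrite addr_ge0 // mulr_ge0 // ltW.
set DD := (_ ^+ 2 + _ ^+ 2 in ltRHS).
have DDe : e ^+ 2 <= DD.
  apply: le_trans (_ : (1 + iota * dt * x) ^+ 2 <= _).
    by rewrite ler_sqr ?nnegrE //; lra.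
  rewrite /DD (_ : 1 + (_ - _) = 1 + iota * dt * x); last by ring.
  by rewrite lerDl sqr_ge0.
have ee : 0 < e ^+ 2 by rewrite exprn_gt0.
have k1 : M < K * e ^+ 2.
  rewrite -ltr_pdivrMr // /K; lra.
have k2 : M ^+ 2 <= (K * e) ^+ 2.
  rewrite ler_sqr ?nnegrE ?mulr_ge0 ?(ltW K0) ?(ltW e0) // -ler_pdivrMr // /K; lra.
have : (2 * (K * dt) + (K * dt) ^+ 2) * e ^+ 2 <= (2 * (K * dt) + (K * dt) ^+ 2) * DD.
  by rewrite ler_wpM2l // addr_ge0 ?sqr_ge0 // !mulr_ge0 // ltW.
have : dt * M < dt * (K * e ^+ 2) by rewrite ltr_pM2l.
have : dt ^+ 2 * M ^+ 2 <= dt ^+ 2 * (K * e) ^+ 2 by rewrite ler_wpM2l ?sqr_ge0.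
have -> : (1 - ((1 - iota) * dt * x - 0 * y)) ^+ 2 +
          (0 - ((1 - iota) * dt * y + 0 * x)) ^+ 2 =
  DD + (- 2 * dt * x - (2 * iota - 1) * (dt ^+ 2 * (x ^+ 2 + y ^+ 2))).
  by rewrite /DD; ring.
by move: (DD) => E; lra.
Qed.

(** The margin at the largest step [tau] serves every smaller step, which keeps [K] independent of
    [dt]. *)
Lemma denominator_ge {R : realType} (d iota tau dt x : R) :
  d < 0 -> 0 <= iota -> dt <= tau -> 0 < dt -> d <= x ->
  1 + iota * tau * d <= 1 + iota * dt * x.
Proof.
move=> d0 i0 dtt dt0 dx; rewrite lerD2l.
apply: le_trans (_ : iota * dt * d <= _).
  by rewrite ler_wnM2r ?(ltW d0) // ler_wpM2l.
by rewrite ler_wpM2l // mulr_ge0 // ltW.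
Qed.

Lemma timestep_margin_gt0 {R : realType} (d iota tau : R) :
  d < 0 -> 0 <= iota -> (0 < iota -> tau < - (1 / (iota * d))) ->
  0 < 1 + iota * tau * d.
Proof.
(* For [iota = 0] the step bound is void and the margin is 1. *)
move=> d0; rewrite le_eqVlt => /predU1P[<- _|i0 /(_ i0)]; first by rewrite !mul0r addr0.
rewrite -mulrN -invrN mul1r => ht.
have id0 : 0 < - (iota * d) by rewrite oppr_gt0 pmulr_rlt0.
have : tau * - (iota * d) < 1 by rewrite -ltr_pdivlMr // mul1r.
lra.
Qed.

(** * Bounds on the full symbol, uniform in the phase angles *)

Section SymbolBounds.
Variables (R : realType) (alpha1 alpha2 beta c1 c2 d h k : R).
Hypotheses (halpha1 : 0 < alpha1) (halpha2 : 0 < alpha2).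
Hypothesis hbeta : beta ^+ 2 < 4 * alpha1 * alpha2.
Hypotheses (h0 : 0 < h) (k0 : 0 < k).

Lemma parabolic_symbol_ge0 tx ty : 0 <= parabolic_symbol alpha1 alpha2 beta h k tx ty.
Proof.
have := mixed_symbol_le alpha1 alpha2 beta h k tx ty (lt0r_neq0 h0) (lt0r_neq0 k0)
  halpha1 halpha2 hbeta.
by rewrite ler_norml => /andP[+ _]; rewrite /parabolic_symbol; lra.
Qed.

Lemma parabolic_symbol_le tx ty :
  parabolic_symbol alpha1 alpha2 beta h k tx ty <=
  2 * (alpha1 * (12 / h ^+ 2) + alpha2 * (12 / k ^+ 2)).
Proof.
have := mixed_symbol_le alpha1 alpha2 beta h k tx ty (lt0r_neq0 h0) (lt0r_neq0 k0)
  halpha1 halpha2 hbeta.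
have := ler_wpM2l (ltW halpha1) (diffusion_symbol_le h tx).
have := ler_wpM2l (ltW halpha2) (diffusion_symbol_le k ty).
by rewrite ler_norml => ? ? /andP[_ +]; rewrite /parabolic_symbol; lra.
Qed.

Lemma convection_symbol_le tx ty :
  `|convection_symbol c1 c2 h k tx ty| <= `|c1| * (3 / h) + `|c2| * (3 / k).
Proof.
rewrite /convection_symbol (le_trans (ler_normD _ _)) // (normrM c1) (normrM c2).
by apply: lerD; apply: ler_wpM2l => //; exact: pade_slope_le.
Qed.

(** The bound on the real part controls the term linear in [dt]; the bound on the squared modulus
    controls the quadratic term, which has the wrong sign when [iota < 1 / 2]. *)
Lemma compact_symbol_bounded : exists M : R, 0 <= M /\ forall tx ty,
  let lam := compact_symbol alpha1 alpha2 beta c1 c2 d h k tx ty in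
  - complex.Re lam <= M /\ complex.Re lam ^+ 2 + complex.Im lam ^+ 2 <= M ^+ 2.
Proof.
set A := 2 * (alpha1 * (12 / h ^+ 2) + alpha2 * (12 / k ^+ 2)) + `|d|.
set B := `|c1| * (3 / h) + `|c2| * (3 / k).
have B0 : 0 <= B by rewrite addr_ge0 // mulr_ge0 // divr_ge0 // ltW.
have A0 : 0 <= A.
  by rewrite addr_ge0 // mulr_ge0 // addr_ge0 // mulr_ge0 ?(ltW halpha1) ?(ltW halpha2)
    // divr_ge0 // sqr_ge0.
(* [A] and [B] bound the real and imaginary parts, and [A^2 + B^2 <= (A + B)^2]. *)
exists (A + B); split=> [|tx ty /=]; first exact: addr_ge0.
have hp0 := parabolic_symbol_ge0 tx ty; have hpA := parabolic_symbol_le tx ty.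
have hcB := convection_symbol_le tx ty.
have hd1 := ler_norm d; have hd2 := ler_normr d `|d|.
have hd3 : - d <= `|d| by rewrite -normrN ler_norm.
have hx : `|parabolic_symbol alpha1 alpha2 beta h k tx ty + d| <= A.
  by rewrite ler_norml; apply/andP; split; rewrite /A; lra.
split; first by rewrite -/B in hcB; move: hx; rewrite ler_norml => /andP[]; lra.
have x2 : (parabolic_symbol alpha1 alpha2 beta h k tx ty + d) ^+ 2 <= A ^+ 2.
  by rewrite -real_normK ?num_real // ler_sqr.
have y2 : (convection_symbol c1 c2 h k tx ty) ^+ 2 <= B ^+ 2.
  by rewrite -real_normK ?num_real // ler_sqr.
have : 0 <= A * B by rewrite mulr_ge0.
lra.
Qed.

End SymbolBounds.

(** * Stability of the scheme *)

Theorem theorem1 (R : realType) (alpha1 alpha2 beta c1 c2 d : R)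
    (halpha1 : 0 < alpha1) (halpha2 : 0 < alpha2)
    (hbeta : beta ^+ 2 < 4 * alpha1 * alpha2) :
  (0 <= d ->
    forall iota : R, 1 / 2 <= iota <= 1 ->
    forall h k dt : R, 0 < h -> 0 < k -> 0 < dt ->
      von_neumann_stable alpha1 alpha2 beta c1 c2 d h k iota dt)
  /\
  (d < 0 ->
    forall iota : R, 0 <= iota <= 1 ->
    (* for iota = 0 the bound - 1 / (iota * d) is +oo *)
    forall tau : R, (0 < iota -> tau < - (1 / (iota * d))) ->
      (* K may depend on the mesh *)
      (forall h k : R, 0 < h -> 0 < k ->
        exists K : R, forall dt : R, 0 < dt <= tau ->
          von_neumann_growth_bounded alpha1 alpha2 beta c1 c2 d h k iota dt K)
      /\
      (* K is also uniform in the mesh *)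
      (1 / 2 <= iota ->
        exists K : R, forall h k dt : R, 0 < h -> 0 < k -> 0 < dt <= tau ->
          von_neumann_growth_bounded alpha1 alpha2 beta c1 c2 d h k iota dt K)).
Proof.
split=> [d0 iota /andP[iota2 _] h k dt h0 k0 dt0 tx ty _ _
       | d0 iota /andP[iota0 iota1] tau htau].
  have px := parabolic_symbol_ge0 R _ _ beta _ _ halpha1 halpha2 hbeta h0 k0 tx ty.
  have [D0 G1] := theta_factor_le1 iota dt _ (convection_symbol c1 c2 h k tx ty)
    iota2 dt0 (addr_ge0 px d0).
  by eexists; split; first exact: (amplification_factorP _ _ _ _ _ _ _ _ _ _ _ _
    (lt0r_neq0 h0) (lt0r_neq0 k0) D0).
have e0 := timestep_margin_gt0 d iota tau d0 iota0 htau.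
set e := 1 + iota * tau * d in e0.
(* The resulting constant depends on the mesh only through [M], so both growth claims reduce to a
   choice of [M]. *)
have growth h k dt M : 0 < h -> 0 < k -> 0 < dt <= tau -> 0 <= M ->
    (forall tx ty x y,
      compact_symbol alpha1 alpha2 beta c1 c2 d h k tx ty = Complex x y ->
      - 2 * dt * x - (2 * iota - 1) * (dt ^+ 2 * (x ^+ 2 + y ^+ 2))
        <= 2 * dt * M + dt ^+ 2 * M ^+ 2) ->
    von_neumann_growth_bounded alpha1 alpha2 beta c1 c2 d h k iota dt
      (M / e ^+ 2 + M / e + 1).
  move=> h0 k0 /andP[dt0 dtt] M0 hM tx ty _ _.
  have px := parabolic_symbol_ge0 R _ _ beta _ _ halpha1 halpha2 hbeta h0 k0 tx ty.
  have eD := denominator_ge d iota tau dt _ d0 iota0 dtt dt0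
    (_ : d <= parabolic_symbol alpha1 alpha2 beta h k tx ty + d).
  have [|D0 G1] := theta_factor_lt _ _ _ _ _ _ dt0 e0 (eD _) M0 (hM tx ty _ _ erefl).
    by rewrite lerDr.
  by eexists; split; first exact: (amplification_factorP _ _ _ _ _ _ _ _ _ _ _ _
    (lt0r_neq0 h0) (lt0r_neq0 k0) D0).
split=> [h k h0 k0 | iota2].
  (* For arbitrary [iota], [M] bounds the whole symbol and so depends on [h] and [k]. *)
  have [M [M0 hM]] := compact_symbol_bounded R _ _ beta c1 c2 d _ _ halpha1 halpha2
    hbeta h0 k0.
  eexists => dt hdt; apply: (growth h k dt M) => // tx ty x y lamE.
  case: (hM tx ty); rewrite lamE /= => xM xyM; have /andP[dt0 _] := hdt.
  have : dt * - x <= dt * M by rewrite ler_wpM2l // ltW.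
  have := ler_wpM2l (sqr_ge0 dt) xyM.
  have : 0 <= iota * (dt ^+ 2 * (x ^+ 2 + y ^+ 2)).
    by rewrite mulr_ge0 // mulr_ge0 ?addr_ge0 ?sqr_ge0.
  lra.
eexists => h k dt h0 k0 hdt.
(* The quadratic term now has a favourable sign and the real part of the symbol is at least [d], so
   [- d] suffices on every mesh. *)
apply: (growth h k dt (- d)) => //; first by rewrite oppr_ge0 ltW.
move=> tx ty x y [xE _]; have /andP[dt0 _] := hdt.
have : dt * - x <= dt * - d.
  apply: ler_wpM2l; first exact: ltW.
  by rewrite lerN2 -xE lerDr; exact: parabolic_symbol_ge0.
have : 0 <= (2 * iota - 1) * (dt ^+ 2 * (x ^+ 2 + y ^+ 2)).
  apply: mulr_ge0; first by lra.
  by rewrite mulr_ge0 ?addr_ge0 ?sqr_ge0.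
have : 0 <= dt ^+ 2 * (- d) ^+ 2 by rewrite mulr_ge0 ?sqr_ge0.
lra.
Qed.
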